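(* Let $X$ be a separable Banach space, $T$ a bounded linear operator on $X$ and $\Lambda \subset (0,+\infty)$ a set with at least two elements. Assume that there exist a dense subset $X_0$ of $X$ and a mapping $S:X_0 \to X_0$ such that $T(S(x))=x$ for all $x\in X_0$. Suppose also that $a_T(X_0,S)=1/r(T)$ and $b_T(X_0,S)=+\infty$. Then $$\bigcap_{\lambda \in \Lambda}FHC(\lambda T)\neq \emptyset$$ if and only if $\Lambda$ is countable and relatively compact in $(1/r(T),+\infty)$.
   Context: $\mathbb{N}=\{0,1,2,\ldots\}$. $r(T)=\lim_{n\to\infty}\Vert T^n\Vert^{1/n}$ is the spectral radius of $T$, with the convention $1/0=+\infty$. Given $X_0$ dense in $X$ and a map $S:X_0\to X_0$ with $T(S(x))=x$ for $x\in X_0$, set $$a_T(X_0,S)=\inf\Big\{\lambda>0:\ \sum_{n\geq 0}\frac{S^n(x)}{\lambda^n}\text{ converges unconditionally for all }x\in X_0\Big\}=\inf\{\lambda>0:\ (\lambda^{-n}S^n(x))_{n\in\mathbb{N}}\text{ is bounded for all }x\in X_0\},$$ $$b_T(X_0,S)=\sup\Big\{\lambda>0:\ \sum_{n\geq 0}(\lambda T)^n(x)\text{ converges unconditionally for all }x\in X_0\Big\}=\sup\{\lambda>0:\ ((\lambda T)^n(x))_{n\in\mathbb{N}}\text{ is bounded for all }x\in X_0\}.$$ $FHC(T)$ is the set of frequently hypercyclic vectors of $T$: those $x\in X$ such that for every non-empty open $U\subset X$, $\underline{d}(\{n\in\mathbb{N}:T^n(x)\in U\})>0$, where $\underline{d}(E)=\liminf_{n\to\infty}\frac{\mathrm{card}([0,n]\cap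 E)}{n+1}$. A subset of an open interval $I$ is relatively compact in $I$ if its closure is a compact subset of $I$. *)

(* Defs.v *)
From HB Require Import structures.
From mathcomp Require Import all_boot all_order all_algebra.
From mathcomp Require Import complex.
From mathcomp Require Import all_classical all_reals all_analysis.
Import Order.TTheory GRing.Theory Num.Theory.
Import numFieldNormedType.Exports.

Set Implicit Arguments.
Unset Strict Implicit.
Unset Printing Implicit Defensive.

Local Open Scope classical_set_scope.
Local Open Scope ring_scope.

(* Banach spaces are real or complex. The norm of a normedModType K takes its
   values in K, so for complex scalars it is read back in R by real_part. *)
Variant scalars := RealScalars | ComplexScalars.

Definition scalar_field (R : realType) (s : scalars) : numFieldType :=
  match s with
  | RealScalars => R : numFieldType
  | ComplexScalars => R[i]%C : numFieldType
  end.

Definition of_real (R : realType) (s : scalars) : R -> scalar_field R s :=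
  match s with
  | RealScalars => id
  | ComplexScalars => real_complex R
  end.

Definition real_part (R : realType) (s : scalars) : scalar_field R s -> R :=
  match s with
  | RealScalars => id
  | ComplexScalars => @complex.Re R
  end.

Definition separable (X : topologicalType) : Prop :=
  exists D : set X, countable D /\ dense D.

Section Operators.
Context {R : realType} {s : scalars} {X : completeNormedModType (scalar_field R s)}.
Implicit Types (T S : X -> X) (lambda : R).

Definition rnorm (x : X) : R := real_part `|x|.

Definition opnorm T : R := sup [set rnorm (T x) | x in [set x | rnorm x <= 1]].

(* The term n = 0 has exponent 0^-1 = 0 and is irrelevant to the limit. *)
Definition spectral_radius T : R :=
  limn (fun n : nat => opnorm (iter n T) `^ n%:R^-1).

Definition scale_op lambda T : X -> X := fun x => of_real s lambda *: T x.

Definition unconditionally_convergent (u : nat -> X) : Prop :=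
  forall sigma : nat -> nat, bijective sigma -> cvgn (series (u \o sigma)).

(* Only the values of S on X0 matter. The infimum is taken in [-oo, +oo], so
   that inf set0 = +oo. *)
Definition a_exponent (X0 : set X) S : \bar R :=
  ereal_inf [set lambda%:E | lambda in [set lambda | 0 < lambda /\
    forall x, X0 x -> unconditionally_convergent
      (fun n => of_real s (lambda ^- n) *: iter n S x)]].

(* The supremum is taken in [-oo, +oo], so that sup set0 = -oo. *)
Definition b_exponent T (X0 : set X) : \bar R :=
  ereal_sup [set lambda%:E | lambda in [set lambda | 0 < lambda /\
    forall x, X0 x -> unconditionally_convergent
      (fun n => iter n (scale_op lambda T) x)]].

End Operators.

Definition lower_density (R : realType) (E : set nat) : \bar R :=
  limn_einf (fun n : nat => (#|[set i : 'I_n.+1 | `[< E i >]]%SET|%:R / n.+1%:R)%:E).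

(* FHC R T; R is only the field in which the densities are computed. *)
Definition FHC (R : realType) (X : topologicalType) (T : X -> X) : set X :=
  [set x | forall U : set X, open U -> U !=set0 ->
     (0 < lower_density R [set n : nat | U (iter n T x)])%E].

Definition relatively_compact_in (R : realType) (I A : set R) : Prop :=
  compact (closure A) /\ closure A `<=` I.

(* Main.v *)
Require Import Defs.
From HB Require Import structures.
From mathcomp Require Import all_boot all_order all_algebra.
From mathcomp Require Import all_classical all_reals all_analysis.
From mathcomp Require Import zify ring lra.
From mathcomp Require complex.
Import Order.TTheory GRing.Theory Num.Theory.
Import numFieldNormedType.Exports.
Set Implicit Arguments.
Unset Strict Implicit.
Unset Printing Implicit Defensive.
Local Open Scope classical_set_scope.
Local Open Scope ring_scope.

(** The equivalence rests on comparing visiting times of different multiples of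
[T].

Suppose first that [x] is frequently hypercyclic for every [lambda * T], with
[lambda] in [Lambda], and let [r] be the spectral radius. The times at which the
orbit of [x] under [lambda * T] lies in the annulus [1 < |z| < 2] form a set of
positive lower density, and at such a time [n] the norm of [T ^ n x] is
[lambda ^ - n] up to a factor 2.
- Different parameters therefore have almost disjoint sets of visits, and at most
  [K] almost disjoint sets can have lower density at least [1/K]: [Lambda] is
  countable ([Lambda_countable]).
- Positive lower density makes consecutive visits have a bounded ratio. If [mu]
  visits at time [n] and [lambda] at a later time [m <= K * n], then [T ^ (m - n)]
  must multiply [T ^ n x] by about [mu ^ n / lambda ^ m], which its growth rate
  [r] only permits if [mu / lambda] is at most [max 1 (lambda * r) ^ K]
  ([visits_ratio_le]). With [lambda] fixed this bounds [Lambda] above; with [mu]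
  fixed it keeps [Lambda] away from [1/r].

Conversely, let [Lambda] be countable with closure between [A] and [B], where
[A] exceeds [1/r = a]. Then [lambda ^ - n * S ^ n] decays exponentially on [X0],
uniformly in [lambda], and [T ^ n] decays there faster than any exponential.
Countably many targets, pairs of a parameter [lam k] and a vector [xs k] of [X0], are served by
the single vector that sums [lam k ^ - n * S ^ n (xs k)] over all [k] and all [n]
in a set [E k] of positive lower density ([frequent_approximation]). The ratios
[(lam j / lam k) ^ m] that appear when the wrong multiple of [T] acts on a term
are exponentially large; they are beaten by the decay because the sets [E k] can
be taken in disjoint families of blocks, each block running from some [b ^ i] to
[2 * b ^ i - 1], so that times of different targets are far apart relative to
their size ([separated_sets]). *)

(** * The real-valued norm over real or complex scalars *)

Section ScalarField.
Context {R : realType} {s : scalars}.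
Implicit Types (r : R) (y : scalar_field R s).

Lemma of_real1 : of_real s (1 : R) = 1.
Proof. by case: s. Qed.

Lemma of_real0 : of_real s (0 : R) = 0.
Proof. by case: s. Qed.

Lemma of_realM r1 r2 : of_real s (r1 * r2) = of_real s r1 * of_real s r2.
Proof.
by case: s => //; congr (complex.Complex _ _); rewrite /= ?mulr0 ?mul0r ?subr0 ?addr0.
Qed.

Lemma ler_of_real r1 r2 : (of_real s r1 <= of_real s r2) = (r1 <= r2).
Proof. by case: s => //=; exact: complex.lecR. Qed.

Lemma ltr_of_real r1 r2 : (of_real s r1 < of_real s r2) = (r1 < r2).
Proof. by case: s => //=; exact: complex.ltcR. Qed.

Lemma of_realD r1 r2 : of_real s (r1 + r2) = of_real s r1 + of_real s r2.
Proof.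
by case: s => //; congr (complex.Complex _ _); rewrite /= addr0.
Qed.

Lemma of_realK : cancel (of_real s) (@real_part R s).
Proof. by case: s. Qed.

Lemma real_partK y : 0 <= y -> of_real s (real_part y) = y.
Proof.
by case: s y => //= -[a b] /complex.ger0_Im /= ->.
Qed.

Lemma real_part_ge0 y : 0 <= y -> 0 <= real_part y.
Proof. by move=> y0; rewrite -ler_of_real of_real0 real_partK. Qed.
End ScalarField.

Section RealNorm.
Context {R : realType} {s : scalars} {X : completeNormedModType (scalar_field R s)}.
Implicit Types (x y : X) (r : R).

Lemma of_real_rnorm x : of_real s (rnorm x) = `|x|.
Proof. exact/real_partK. Qed.

Lemma rnorm_ge0 x : 0 <= rnorm x.
Proof. exact: real_part_ge0. Qed.

Lemma rnorm0 : rnorm (0 : X) = 0.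
Proof. by rewrite /rnorm normr0 -of_real0 of_realK. Qed.

Lemma rnorm_eq0 x : rnorm x = 0 -> x = 0.
Proof. by move=> x0; apply/normr0_eq0; rewrite -of_real_rnorm x0 of_real0. Qed.

Lemma rnormN x : rnorm (- x) = rnorm x.
Proof. by rewrite /rnorm normrN. Qed.

Lemma rnormD x y : rnorm (x + y) <= rnorm x + rnorm y.
Proof. by rewrite -(@ler_of_real _ s) of_realD !of_real_rnorm ler_normD. Qed.

Lemma rnormZ r x : 0 <= r -> rnorm (of_real s r *: x) = r * rnorm x.
Proof.
move=> r0; apply: (can_inj (@of_realK R s)); rewrite of_realM !of_real_rnorm.
by rewrite normrZ ger0_norm// -of_real0 ler_of_real.
Qed.

Lemma rnorm_sum (I : Type) (q : seq I) (P : pred I) (F : I -> X) :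
  rnorm (\sum_(i <- q | P i) F i) <= \sum_(i <- q | P i) rnorm (F i).
Proof.
elim/big_rec2: _ => [|i a z Pi IH]; first by rewrite rnorm0.
by apply: le_trans (rnormD _ _) _; rewrite lerD2l.
Qed.

(** Convergence tests in [X] quantify over positive elements of the scalar
field. Such elements are real, so real-valued epsilons suffice; the next lemmas
transfer limits, neighbourhoods and open sets to the real-valued norm. *)
Lemma cvg_rnormP (u : nat -> X) x : u @ \oo --> x <->
  forall e : R, 0 < e -> \forall n \near \oo, rnorm (x - u n) < e.
Proof.
split=> [/cvgrPdist_lt h e e0|h].
  have : 0 < of_real s e by rewrite -of_real0 ltr_of_real.
  by move=> /h; apply: filterS => n; rewrite -of_real_rnorm ltr_of_real.
apply/cvgrPdist_lt => e e0.
have : 0 < real_part e by rewrite -(@ltr_of_real _ s) of_real0 real_partK// ltW.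
move=> /h; apply: filterS => n.
by rewrite -of_real_rnorm -{2}(real_partK (ltW e0)) ltr_of_real.
Qed.

Lemma nbhs_rnormP x (A : set X) : nbhs x A <->
  exists2 e : R, 0 < e & forall y, rnorm (x - y) < e -> A y.
Proof.
split=> [/nbhs_normP[e e0 eA]|[e e0 eA]].
  exists (real_part e); first by rewrite -(@ltr_of_real _ s) of_real0 real_partK// ltW.
  move=> y xy; apply: eA => /=.
  by rewrite -of_real_rnorm -(real_partK (ltW e0)) ltr_of_real.
apply/nbhs_normP; exists (of_real s e); first by rewrite /= -of_real0 ltr_of_real.
by move=> y /=; rewrite -of_real_rnorm ltr_of_real; exact: eA.
Qed.

Lemma open_rnormP (A : set X) : open A <->
  forall x, A x -> exists2 e : R, 0 < e & forall y, rnorm (x - y) < e -> A y.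
Proof.
by rewrite openE; split=> h x /h /nbhs_rnormP.
Qed.

Lemma cvg_series_geometric (u : nat -> X) (C q : R) : 0 <= q < 1 ->
  (forall n, rnorm (u n) <= C * q ^+ n) -> cvgn (series u).
Proof.
move=> /andP[q0 q1] uC; apply/cauchy_cvgP/cauchy_seriesP => e e0.
have e'0 : 0 < real_part e by rewrite -(@ltr_of_real _ s) of_real0 real_partK// ltW.
have := @is_cvg_geometric_series R C q; rewrite ger0_norm// => /(_ q1).
move=> /cauchy_cvgP/cauchy_seriesP/(_ _ e'0); apply: filterS => -[m n] /=.
rewrite -of_real_rnorm -{2}(real_partK (ltW e0)) ltr_of_real; apply: le_lt_trans.
apply: le_trans (rnorm_sum _ _ _) (le_trans _ (ler_norm _)).
exact: ler_sum.
Qed.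

Lemma cvgn_rnorm_bounded (u : nat -> X) : cvgn (series u) ->
  exists2 C : R, 0 < C & forall n, rnorm (u n) <= C.
Proof.
move=> /cvg_series_cvg_0 /cvgP /cvg_seq_bounded [C [Creal hC]].
have C1 : C < `|C| + 1.
  by rewrite (le_lt_trans (real_ler_norm Creal))// ltrDl.
have C0 : 0 <= `|C| + 1 by rewrite addr_ge0.
exists (real_part (`|C| + 1)).
  by rewrite -(@ltr_of_real _ s) of_real0 real_partK// ltr_wpDl.
move=> n; rewrite -(@ler_of_real _ s) of_real_rnorm real_partK//.
exact: (hC _ C1).
Qed.

(** The distance from the sum of a series to its [m]-th term is controlled by
the other terms. This is how the orbit of a vector defined by a series is
compared with the single term that is meant to dominate at time [m]. *)
Lemma rnorm_series_sub_le (u : nat -> X) (l : X) m (B : R) : series u @ \oo --> l ->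
  (forall p, \sum_(0 <= n < p | n != m) rnorm (u n) <= B) ->
  rnorm (l - u m) <= B.
Proof.
move=> /cvg_rnormP ul uB; apply/ler_addgt0Pr => e e0.
have [N _ hN] := ul e e0.
pose p := maxn N m.+1.
have /hN : (N <= p)%N by rewrite leq_maxl.
rewrite /= => h.
have -> : l - u m = (\sum_(0 <= n < p | n != m) u n) + (l - series u p).
  rewrite /series/= [\sum_(0 <= k < p) _](bigD1_seq m)/= ?iota_uniq//; last first.
    by rewrite mem_index_iota/= leq_maxr.
  by rewrite [u m + _]addrC opprD addrCA addNKr.
apply: le_trans (rnormD _ _) _; apply: lerD (ltW h).
exact: le_trans (rnorm_sum _ _ _) (uB p).
Qed.
End RealNorm.

(** * Growth of the iterates and the spectral radius *)

Lemma geometric_eventually_lt {R : realType} (q e : R) : 0 <= q < 1 -> 0 < e ->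
  exists N, forall n, (N <= n)%N -> q ^+ n < e.
Proof.
move=> /andP[q0 q1] e0.
have /cvgrPdist_lt/(_ e e0)[N _ hN] : (fun n => q ^+ n) @ \oo --> 0.
  by apply: cvg_expr; rewrite ger0_norm.
exists N => n /hN /=; rewrite sub0r normrN ger0_norm// exprn_ge0//.
Qed.

Lemma exprn_eventually_gt {R : realType} (q M : R) : 1 < q ->
  exists N, forall n, (N <= n)%N -> M < q ^+ n.
Proof.
move=> q1; have q0 : 0 < q := lt_trans ltr01 q1.
have M0 : 0 < `|M| + 1 by rewrite ltr_wpDl.
have := @geometric_eventually_lt R q^-1 (`|M| + 1)^-1.
rewrite invr_ge0 (ltW q0)/= invf_lt1// q1 invr_gt0 M0 => /(_ isT isT)[N hN].
exists N => n /hN; rewrite exprVn ltf_pV2 ?posrE ?exprn_gt0// => h.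
by rewrite (le_lt_trans (ler_norm M))// (lt_trans _ h)// ltrDl.
Qed.

(** Fekete's lemma in multiplicative form. With [l] the infimum of the roots,
any [rho > l] bounds one root [u k ^ (1/k)]; Euclidean division by [k] then gives
[u n <= C * rho ^ n] for all [n], and the constant [C] is absorbed by an
arbitrarily small increase of [rho]. *)
Lemma fekete {R : realType} (u : nat -> R) : (forall n, 0 <= u n) ->
  (forall m n, u (m + n)%N <= u m * u n) ->
  exists l, [/\ (fun n : nat => u n `^ n%:R^-1) @ \oo --> l,
    0 <= l, l <= u 1%N &
    forall rho, l < rho -> exists2 C, 0 < C & forall n, u n <= C * rho ^+ n].
Proof.
move=> u0 uM.
pose A := [set u n.+1 `^ n.+1%:R^-1 | n in setT].
have lbA : lbound A 0 by move=> _ [n _ <-]; exact: powR_ge0.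
have A0 : A !=set0 by exists (u 1 `^ 1%:R^-1), 0%N.
have iA : has_inf A by split => //; exists 0.
pose l := inf A.
have l0 : 0 <= l by apply: lb_le_inf.
have ln n : l <= u n.+1 `^ n.+1%:R^-1 by apply: ge_inf; [exists 0|exists n].
have powK n : (u n.+1 `^ n.+1%:R^-1) ^+ n.+1 = u n.+1.
  by rewrite -powR_mulrn ?powR_ge0// -powRrM mulVf ?powRr1// pnatr_eq0.
have growth rho : l < rho -> exists2 C, 0 < C & forall n, u n <= C * rho ^+ n.
  move=> lrho; have rho0 : 0 < rho := le_lt_trans l0 lrho.
  have [_ [k _ <-] uk] := inf_lt A0 lrho.
  have {}uk : u k.+1 <= rho ^+ k.+1.
    by rewrite -powK lerXn2r ?nnegrE ?powR_ge0 ?(ltW rho0)// ltW.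
  have t0 (i : nat) : 0 <= u i / rho ^+ i by rewrite divr_ge0// exprn_ge0// ltW.
  exists (1 + \sum_(i < k.+1) u i / rho ^+ i).
    by rewrite ltr_pwDl// sumr_ge0.
  move=> n; have [m] := ubnP n; elim: m n => // m IH n nm.
  have [nk|kn] := ltnP n k.+1.
    rewrite -ler_pdivrMr ?exprn_gt0// (bigD1 (Ordinal nk))//= addrCA lerDl.
    by rewrite addr_ge0// sumr_ge0.
  rewrite -(subnKC kn); apply: le_trans (uM _ _) _.
  rewrite exprD mulrCA; apply: ler_pM => //; apply: IH; lia.
exists l; split => //.
  apply/cvgrPdist_le => e e0.
  have rho1 : l < l + e / 2 by rewrite ltrDl divr_gt0.
  have le0 : 0 < l + e by rewrite ltr_wpDl.
  have [C C0 hC] := growth _ rho1.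
  have [||N hN] := @geometric_eventually_lt R ((l + e / 2) / (l + e)) C^-1.
  - rewrite divr_ge0/=; [|lra|lra].
    by rewrite ltr_pdivrMr// mul1r; lra.
  - by rewrite invr_gt0.
  exists N.+1 => // -[//|n] /= Nn.
  rewrite distrC ger0_norm ?subr_ge0 ?ln// lerBlDl.
  rewrite -(@ler_pXn2r _ n.+1)// ?nnegrE ?powR_ge0 ?(ltW le0)// powK.
  apply: le_trans (hC _) _; have := hN n.+1 (ltnW Nn).
  by rewrite expr_div_n ltr_pdivrMr ?exprn_gt0// ltr_pdivlMl// => /ltW.
by have := ln 0%N; rewrite invr1 powRr1.
Qed.

Section OperatorNorm.
Context {R : realType} {s : scalars} {X : completeNormedModType (scalar_field R s)}.
Implicit Types (x y : X) (r : R).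

Section HomogeneousMap.
Variables (f : X -> X) (M : R).
Hypothesis fM : forall x, rnorm (f x) <= M * rnorm x.
Hypothesis fZ : forall r x, f (of_real s r *: x) = of_real s r *: f x.

Let has_sup_opnorm : has_sup [set rnorm (f x) | x in [set x | rnorm x <= 1]].
Proof.
split; first by exists (rnorm (f 0)), 0 => //=; rewrite rnorm0.
exists `|M| => _ [x /= x1 <-]; apply: le_trans (fM x) _.
apply: (@le_trans _ _ (`|M| * rnorm x)); first by rewrite ler_wpM2r ?rnorm_ge0 ?ler_norm.
by rewrite ler_piMr.
Qed.

Lemma opnorm_ge0 : 0 <= opnorm f.
Proof.
apply: le_trans (rnorm_ge0 (f 0)) _; apply: ub_le_sup; first by case: has_sup_opnorm.
by exists 0 => //=; rewrite rnorm0.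
Qed.

Lemma rnorm_le_opnorm x : rnorm (f x) <= opnorm f * rnorm x.
Proof.
have [x0|x0] := eqVneq (rnorm x) 0.
  by rewrite x0 mulr0 (le_trans (fM x))// x0 mulr0.
have {}x0 : 0 < rnorm x by rewrite lt_def x0 rnorm_ge0.
rewrite mulrC -ler_pdivrMl// -rnormZ ?invr_ge0 ?rnorm_ge0// -fZ.
apply: ub_le_sup; first by case: has_sup_opnorm.
exists (of_real s (rnorm x)^-1 *: x) => //=.
by rewrite rnormZ ?invr_ge0 ?rnorm_ge0// mulVf// gt_eqF.
Qed.

Lemma opnorm_le : 0 <= M -> opnorm f <= M.
Proof.
move=> M0; apply: ge_sup; first by case: has_sup_opnorm.
move=> _ [x /= x1 <-]; apply: le_trans (fM x) _.
by rewrite ler_piMr.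
Qed.
End HomogeneousMap.

Variable T : {linear X -> X}.

Lemma iter_scaler n a x : iter n T (a *: x) = a *: iter n T x.
Proof. by elim: n => //= n ->; rewrite linearZ. Qed.

Lemma iter_sum n (I : Type) (q : seq I) (F : I -> X) :
  iter n T (\sum_(i <- q) F i) = \sum_(i <- q) iter n T (F i).
Proof. by elim: n => //= n ->; rewrite linear_sum. Qed.

Lemma iter_scale_op r n x : iter n (scale_op r T) x = of_real s (r ^+ n) *: iter n T x.
Proof.
elim: n => [|n IH]; first by rewrite expr0 of_real1 scale1r.
by rewrite !iterS {1}/scale_op IH linearZ/= scalerA -of_realM -exprS.
Qed.

Hypothesis T_bounded : bounded_near T (nbhs (0 : X)).

Lemma bounded_rnorm : exists2 M : R, 0 <= M & forall x, rnorm (T x) <= M * rnorm x.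
Proof.
have [C [Creal hC]] := (linear_boundedP T).1 T_bounded.
have C1 : C < `|C| + 1 by rewrite (le_lt_trans (real_ler_norm Creal))// ltrDl.
have C0 : 0 <= `|C| + 1 by rewrite addr_ge0.
exists (real_part (`|C| + 1)); first exact: real_part_ge0.
move=> x; rewrite -(@ler_of_real _ s) of_realM !of_real_rnorm real_partK//.
exact: hC.
Qed.

Lemma iter_bounded_rnorm n :
  exists2 M : R, 0 <= M & forall x, rnorm (iter n T x) <= M * rnorm x.
Proof.
have [M M0 hM] := bounded_rnorm; exists (M ^+ n) => [|x]; first exact: exprn_ge0.
elim: n => [|n IH]; first by rewrite mul1r.
by rewrite iterS (le_trans (hM _))// exprS -mulrA ler_wpM2l.
Qed.

Lemma rnorm_iter_le n x : rnorm (iter n T x) <= opnorm (iter n T) * rnorm x.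
Proof.
have [M M0 hM] := iter_bounded_rnorm n.
by apply: (rnorm_le_opnorm hM) => r y; exact: iter_scaler.
Qed.

(** The limit defining the spectral radius exists, so that any [rho] above it
is an exponential growth rate for the iterates. *)
Lemma spectral_radiusP : [/\ 0 <= spectral_radius T, spectral_radius T <= opnorm T &
  forall rho, spectral_radius T < rho ->
    exists2 C, 0 < C & forall n x, rnorm (iter n T x) <= C * rho ^+ n * rnorm x].
Proof.
have [n|m n|l [cvgl l0 l1 growth]] := @fekete R (fun n => opnorm (iter n T)).
- by have [M M0 hM] := iter_bounded_rnorm n; exact: opnorm_ge0 hM.
- have opn0 k : 0 <= opnorm (iter k T).
    by have [M M0 hM] := iter_bounded_rnorm k; exact: opnorm_ge0 hM.
  apply: opnorm_le => [x|]; last by rewrite mulr_ge0.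
  rewrite iterD (le_trans (rnorm_iter_le _ _))// -mulrA ler_wpM2l//.
  exact: rnorm_iter_le.
have -> : spectral_radius T = l by apply: cvg_lim cvgl.
split => // rho /growth[C C0 hC]; exists C => // n x.
by rewrite (le_trans (rnorm_iter_le _ _))// ler_wpM2r ?rnorm_ge0.
Qed.

Lemma cvg_iter n (u : nat -> X) x : u @ \oo --> x ->
  (fun k => iter n T (u k)) @ \oo --> iter n T x.
Proof.
have Tc : continuous T by exact/linear_bounded_continuous.
move=> ux; elim: n => //= n IH; apply: (cvg_comp _ _ IH); exact: Tc.
Qed.
End OperatorNorm.

(** * Sets of positive lower density *)

Definition count_upto (E : set nat) n := #|[set i : 'I_n.+1 | `[< E i >]]%SET|.

(** A purely arithmetical form of positive lower density, in which [K] is an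
upper bound for the inverse of the density. *)
Lemma lower_density_gt0P (R : realType) (E : set nat) : (0 < lower_density R E)%E <->
  exists K N, forall n, (N <= n)%N -> (n.+1 <= count_upto E n * K)%N.
Proof.
rewrite /lower_density limn_einf_lim.
set u := fun n : nat => _.
have -> : limn (einfs u) = ereal_sup (range (einfs u)).
  by apply: cvg_lim => //; exact: cvg_einfs_sup.
split=> [/ereal_sup_gt[_ [N _ <-]] h|[K [N hN]]].
  have einf_le n : (N <= n)%N -> (einfs u N <= u n)%E.
    by move=> Nn; apply: ereal_inf_lbound; exists n.
  have [e eE] : exists e : R, einfs u N = e%:E.
    exists (fine (einfs u N)); rewrite fineK// ge0_fin_numE ?ltW//.
    by apply: le_lt_trans (einf_le N (leqnn N)) _; rewrite ltry.
  rewrite eE lte_fin in h; exists (Num.truncn e^-1).+1, N => n /einf_le.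
  rewrite eE lee_fin ler_pdivlMr// -(ler_nat R) natrM => en.
  have te : 1 < (Num.truncn e^-1).+1%:R * e.
    by rewrite -ltr_pdivrMr// div1r; exact: truncnS_gt.
  have n0 : 0 < n.+1%:R :> R by rewrite ltr0n.
  apply: (le_trans (ltW (_ : n.+1%:R < (Num.truncn e^-1).+1%:R * e * n.+1%:R))).
    by rewrite ltr_pMl.
  by rewrite -mulrA mulrC ler_wpM2r.
have K0 : (0 < K)%N by have := hN _ (leqnn N); case: (K) => //; rewrite muln0.
apply/ereal_sup_gtP; exists (einfs u N); first by exists N.
apply: (@lt_le_trans _ _ (K%:R^-1)%:E); first by rewrite lte_fin invr_gt0 ltr0n.
apply: le_ereal_inf_tmp => _ [n /= Nn <-].
rewrite lee_fin ler_pdivlMr// ler_pdivrMl ?ltr0n// mulrC -natrM ler_nat.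
exact: hN.
Qed.

(** A set of density at least [1/K] has more than [n + 1] elements up to
[2 * K * n], so it must meet the interval from [n + 1] to [2 * K * n]. *)
Lemma dense_bounded_ratio (E : set nat) K N : 
  (forall n, (N <= n)%N -> (n.+1 <= count_upto E n * K)%N) ->
  exists L N', forall n, (N' <= n)%N -> exists m, [/\ E m, (n < m)%N & (m <= L * n)%N].
Proof.
move=> hN; exists (2 * K)%N, N.+1 => n Nn; apply: contrapT => nE.
have K0 : (0 < K)%N by have := hN _ (leqnn N); case: (K) => //; rewrite muln0.
have : (count_upto E (2 * K * n) <= n.+1)%N.
  have nK : (n.+1 <= (2 * K * n).+1)%N by nia.
  rewrite -[leqRHS]card_ord -(@card_imset _ _ (widen_ord nK)); last first.
    by move=> i j /(congr1 val)/= /val_inj.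
  apply: subset_leq_card; apply/fintype.subsetP => i.
  rewrite inE => /asboolP Ei; have [ni|ni] := ltnP n i.
    by exfalso; apply: nE; exists i; split => //; rewrite -ltnS.
  apply/imsetP; exists (Ordinal (ni : (i < n.+1)%N)) => //; exact: val_inj.
have := hN (2 * K * n)%N; nia.
Qed.

(** Sets of density at least [1/K] that meet pairwise in finite sets number at
most [K]. If there were [K + 1] of them, then up to a large [n] they would have
at least [(K + 1) * (n + 1) / K] elements counted with multiplicity, whereas each
integer beyond a fixed bound [M2] is counted at most once. *)
Lemma almost_disjoint_finite (I : choiceType) (E : I -> set nat) (A : set I) K :
  (forall i, A i -> exists N, forall n, (N <= n)%N -> (n.+1 <= count_upto (E i) n * K)%N) ->
  (forall i j, A i -> A j -> i <> j ->
     exists N, forall n, (N <= n)%N -> E i n -> E j n -> False) ->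
  finite_set A.
Proof.

move=> dens disj; apply: contrapT => /(infinite_set_fset K.+1)[B BA KB].
have ss : size (take K.+1 (finmap.enum_fset B)) == K.+1 by rewrite size_takel.
pose s := Tuple ss.
have su : uniq s by rewrite take_uniq// finmap.fset_uniq.
have sA i : i \in s -> A i by move=> /mem_take iB; apply: BA.
have /choice[N1 hN1] : forall i : 'I_K.+1, exists N, forall n, (N <= n)%N ->
    (n.+1 <= count_upto (E (tnth s i)) n * K)%N.
  by move=> i; apply/dens/sA/mem_tnth.
have /choice[N2 hN2] : forall p : 'I_K.+1 * 'I_K.+1, exists N, forall n, (N <= n)%N -> p.1 <> p.2 ->
    E (tnth s p.1) n -> E (tnth s p.2) n -> False.
  move=> [i j] /=; have [->|ij] := eqVneq i j; first by exists 0%N.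
  have [| | |N hN] := disj (tnth s i) (tnth s j); [exact/sA/mem_tnth|exact/sA/mem_tnth| |].
    by move/eqP; rewrite (inj_eq (tuple_uniqP _ su)) (negbTE ij).
  by exists N => n Nn _; exact: hN.
pose M1 := \max_(i < K.+1) N1 i.
pose M2 := \max_(p : 'I_K.+1 * 'I_K.+1) N2 p.
pose n := maxn M1 (K.+1 * K * M2)%N.
(* Lower bound for the double count: each set has its density up to [n]. *)
have h1 : (K.+1 * n.+1 <= \sum_(i < K.+1) count_upto (E (tnth s i)) n * K)%N.
  rewrite -[leqLHS]/(K.+1 * n.+1)%N -{1}(card_ord K.+1) -sum_nat_const.
  apply: leq_sum => i _; apply: hN1.
  by apply: (@leq_trans M1); [exact: leq_bigmax|exact: leq_maxl].
(* Upper bound: integers beyond [M2] belong to at most one set. *)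
have h2 : (\sum_(i < K.+1) count_upto (E (tnth s i)) n <= n.+1 + K.+1 * M2)%N.
  rewrite /count_upto.
  under eq_bigr do rewrite -sum1dep_card big_mkcond/=.
  rewrite exchange_big/=.
  apply: (@leq_trans (\sum_(x < n.+1) (1 + K.+1 * (x < M2)))%N).
    apply: leq_sum => x _; rewrite -big_mkcond/= sum1dep_card.
    have [xM|xM] := ltnP x M2.
      by rewrite muln1 (leq_trans (max_card _))// card_ord.
    rewrite muln0 addn0; apply/card_le1_eqP => i j.
    rewrite !inE => Ei Ej; apply: contrapT => ij.
    apply: (hN2 (j, i) x _ ij Ej Ei).
    apply: leq_trans xM.
    exact: (leq_bigmax (j, i)).
  rewrite big_split/= sum1_card card_ord leq_add2l -big_distrr/= leq_mul2l/=.
  rewrite -(big_mkord xpredT (fun x => (x < M2) : nat)).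
  suff : (\sum_(0 <= x < n.+1) (x < M2) <= minn n.+1 M2)%N by rewrite leq_min => /andP[].
  elim: (n.+1) => [|k IH]; first by rewrite big_geq.
  by rewrite big_nat_recr//=; lia.
have h3 : (K.+1 * K * M2 <= n)%N by rewrite leq_maxr.
rewrite -big_distrl/= in h1.
move: (leq_trans h1 (leq_mul h2 (leqnn K))); nia.
Qed.

(** * Dense sets separated at a geometric scale *)

(** The integers of 2-adic valuation [k] are the odd multiples of [2 ^ k]:
infinitely many disjoint classes, each with bounded gaps. *)
Lemma logn2_syndetic k t : (2 ^ k <= t)%N ->
  exists i, [/\ logn 2 i = k, (i <= t)%N & (t < i + 2 ^ k.+1)%N].
Proof.
move=> kt; have P0 : (0 < 2 ^ k.+1)%N by rewrite expn_gt0.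
set q := ((t - 2 ^ k) %/ 2 ^ k.+1)%N.
exists (2 ^ k * (2 * q).+1)%N.
have hq := divn_eq (t - 2 ^ k) (2 ^ k.+1).
have hr := ltn_pmod (t - 2 ^ k) P0.
have e : (2 ^ k * (2 * q).+1 = 2 ^ k + q * 2 ^ k.+1)%N by rewrite expnS; lia.
split; [|rewrite e; lia|rewrite e; lia].
rewrite lognM ?expn_gt0// pfactorK// logn_coprime ?addn0//.
by rewrite coprime_sym coprimen2/= mul2n odd_double.
Qed.

Section SeparatedSets.
Variables (L : nat) (N : nat -> nat).
Let b := (2 * L + 4)%N.
(** The blocks of integers from [b ^ i] to [2 * b ^ i - 1] are far apart from
each other relative to their size. The [i]-th block is given to the class [k]
of its 2-adic valuation, and within it only multiples of [b ^ N k] are kept,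
which are at least [N k] apart. As class [k] owns blocks with bounded gaps
between their exponents, it owns a positive proportion of the integers. *)
Let E (k : nat) : set nat := [set n | exists i, [/\ logn 2 i = k, (N k < i)%N,
  (b ^ i <= n < 2 * b ^ i)%N & (b ^ N k %| n)%N]].

Let b_gt1 : (1 < b)%N. Proof. by rewrite /b; lia. Qed.
Let leN k : (N k <= b ^ N k)%N. Proof. exact/ltnW/ltn_expl. Qed.

Lemma separated_sets_dense k :
  exists K M, forall n, (M <= n)%N -> (n.+1 <= count_upto (E k) n * K)%N.
Proof.
set P := (2 ^ k.+1)%N.
exists (b ^ (N k + P + 1))%N, (b ^ (N k + P + 2 ^ k + 2))%N => n Mn.
have n0 : (0 < n)%N by apply: leq_trans Mn; rewrite expn_gt0; lia.
set t := trunc_log b n.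
have /andP[tn nt] : (b ^ t <= n < b ^ t.+1)%N by exact: trunc_log_bounds.
have Mt : (N k + P + 2 ^ k + 2 <= t)%N by exact: trunc_log_max.
(* A block of class [k] that ends below [n], but only boundedly many blocks below. *)
have [|i [ik it ti]] := @logn2_syndetic k t.-1; first by lia.
rewrite -/P in ti.
have Ni : (N k < i)%N by lia.
have bi : (2 * b ^ i <= n)%N.
  apply: leq_trans tn; apply: (@leq_trans (b ^ i.+1)).
    by rewrite expnS leq_mul2r b_gt1 orbT.
  by rewrite leq_exp2l//; lia.
have bN0 : (0 < b ^ N k)%N by rewrite expn_gt0; lia.
have be : (b ^ i = b ^ (i - N k) * b ^ N k)%N by rewrite -expnD subnK// ltnW.
have cnt : (b ^ (i - N k) <= count_upto (E k) n)%N.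
  have lt_n (c : 'I_(b ^ (i - N k))) : (b ^ i + c * b ^ N k < n.+1)%N.
    have : (c * b ^ N k <= b ^ (i - N k) * b ^ N k)%N.
      by rewrite leq_mul2r (ltnW (ltn_ord c)) orbT.
    by rewrite -be; lia.
  pose f c := Ordinal (lt_n c).
  rewrite -[leqLHS]card_ord -(@card_imset _ _ f); last first.
    move=> c d /(congr1 val)/= /addnI/eqP; rewrite eqn_pmul2r// => /eqP.
    exact: val_inj.
  apply: subset_leq_card; apply/fintype.subsetP => _ /imsetP[c _ ->].
  rewrite inE /=; apply/asboolP; exists i; split => //.
    rewrite leq_addr/= mul2n -addnn ltn_add2l be ltn_mul2r bN0/=.
    exact: ltn_ord.
  by rewrite dvdn_addr ?dvdn_mull// be dvdn_mull.
apply: leq_trans (leq_mul cnt (leqnn _)).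
apply: leq_trans nt _; rewrite -expnD leq_exp2l//; lia.
Qed.

Lemma separated_sets_ge k n : E k n -> (N k <= n)%N.
Proof.
move=> [i [_ Ni /andP[bn _] _]]; apply: leq_trans (leN k) (leq_trans _ bn).
by rewrite leq_exp2l// ltnW.
Qed.

(** By the choice of [b], elements of distinct blocks differ by at least
[(2 * L + 2) * b ^ (i' - 1)], whereas the smaller one is less than
[2 * b ^ (i' - 1)]. *)
Lemma separated_sets_block j k m n i i' : (b ^ i <= m < 2 * b ^ i)%N ->
  (b ^ i' <= n < 2 * b ^ i')%N -> (N j < i)%N -> (N k < i')%N -> (i < i')%N ->
  [/\ (m < n)%N, (N j <= n - m)%N, (N k <= n - m)%N & (L * m <= n - m)%N].
Proof.
move=> /andP[m1 m2] /andP[n1 n2] ji ki ii.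
have lt_nm : (b * b ^ i'.-1 <= n)%N by rewrite -expnS prednK//; lia.
have ii' : (b ^ i <= b ^ i'.-1)%N by rewrite leq_exp2l//; lia.
have jN : (N j <= b ^ i'.-1)%N.
  by apply: leq_trans (leN j) _; rewrite leq_exp2l//; lia.
have kN : (N k <= b ^ i'.-1)%N.
  by apply: leq_trans (leN k) _; rewrite leq_exp2l//; lia.
have B0 : (0 < b ^ i'.-1)%N by rewrite expn_gt0; lia.
have {m1 m2 ii' B0} mB : (m < 2 * b ^ i'.-1)%N by lia.
move: (b ^ i'.-1)%N jN kN mB lt_nm => B jN kN mB; rewrite /b mulnDl => nB.
have LB : (L * m <= L * (2 * B))%N by rewrite leq_mul2l (ltnW mB) orbT.
by split; lia.
Qed.

Lemma separated_sets_gap j k m n : E j m -> E k n -> (m < n)%N ->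
  [/\ (N j <= n - m)%N, (N k <= n - m)%N & j = k \/ (L * m <= n - m)%N].
Proof.
move=> [i [ij Ni mi dm]] [i' [ik Ni' ni dn]] mn.
have [ii|ii|ii] := ltngtP i i'.
- by have [_ h1 h2 h3] := separated_sets_block mi ni Ni Ni' ii; split=> //; right.
- by have [h _ _ _] := separated_sets_block ni mi Ni' Ni ii; lia.
have jk : j = k by rewrite -ij -ik ii.
rewrite -jk in dn *.
have : (N j <= n - m)%N.
  apply: leq_trans (leN j) _; apply: dvdn_leq; first by rewrite subn_gt0.
  by rewrite dvdn_subl// ltnW.
by split => //; left.
Qed.

Lemma separated_sets_disjoint j k n : E j n -> E k n -> j = k.
Proof.
move=> [i [ij Ni mi dm]] [i' [ik Ni' ni dn]].
have [ii|ii|ii] := ltngtP i i'; last by rewrite -ij -ik ii.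
- by have [] := separated_sets_block mi ni Ni Ni' ii; rewrite ltnn.
- by have [] := separated_sets_block ni mi Ni' Ni ii; rewrite ltnn.
Qed.
End SeparatedSets.

(** The sets along which the common vector will visit its targets. Two visits
are separated by the tolerances [N] of both targets and, when the targets are
different, by [L] times the earlier visiting time. *)
Lemma separated_sets (L : nat) (N : nat -> nat) : exists E : nat -> set nat,
  [/\ forall k, exists K M, forall n, (M <= n)%N -> (n.+1 <= count_upto (E k) n * K)%N,
    forall k n, E k n -> (N k <= n)%N,
    forall j k n, E j n -> E k n -> j = k &
    forall j k m n, E j m -> E k n -> (m < n)%N ->
      [/\ (N j <= n - m)%N, (N k <= n - m)%N & j = k \/ (L * m <= n - m)%N]].
Proof.
by eexists; split; [exact: separated_sets_dense|exact: separated_sets_ge|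
  exact: separated_sets_disjoint|exact: separated_sets_gap].
Qed.

(** * Constraints imposed by a common frequently hypercyclic vector *)

Lemma exprn_root {R : realType} (a : R) n : 0 <= a ->
  exists2 t : R, 0 <= t & t ^+ n.+1 = a.
Proof.
move=> a0; exists (a `^ n.+1%:R^-1); first exact: powR_ge0.
by rewrite -powR_mulrn ?powR_ge0// -powRrM mulVf ?powRr1// pnatr_eq0.
Qed.

Section Annulus.
Context {R : realType} {s : scalars} {X : completeNormedModType (scalar_field R s)}.

(** A visit of the orbit to this open set determines the norm of [T ^ n x] up to
a factor 2. *)
Definition annulus : set X := [set z | 1 < rnorm z < 2].

Lemma annulus_open : open annulus.
Proof.
apply/open_rnormP => z /= /andP[z1 z2].
exists (Num.min (rnorm z - 1) (2 - rnorm z)); first by rewrite lt_min !subr_gt0 z1.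
move=> y; rewrite lt_min => /andP[h1 h2].
have := rnormD (z - y) y; have := rnormD (y - z) z; rewrite !subrK -[y - z]opprB rnormN.
by rewrite /annulus/= => h3 h4; apply/andP; split; lra.
Qed.

Lemma annulus_nonempty (y : X) : y <> 0 -> annulus !=set0.
Proof.
move=> y0; have {}y0 : 0 < rnorm y.
  by rewrite lt_def rnorm_ge0 andbT; apply/eqP => /rnorm_eq0.
exists (of_real s (3 / 2 / rnorm y) *: y).
rewrite /annulus/= rnormZ; last by rewrite !divr_ge0// rnorm_ge0.
by rewrite divfK ?gt_eqF//; lra.
Qed.
End Annulus.

Section CommonVector.
Context {R : realType} {s : scalars} {X : completeNormedModType (scalar_field R s)}.
Variables (T : {linear X -> X}) (x : X).
Hypothesis T_bounded : bounded_near T (nbhs (0 : X)).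
Implicit Types (lambda mu d : R).

Definition visits lambda : set nat :=
  [set n | annulus (iter n (scale_op lambda T) x)].

Lemma visitsE lambda n : 0 < lambda ->
  visits lambda n = (1 < lambda ^+ n * rnorm (iter n T x) < 2) :> Prop.
Proof.
by move=> l0; rewrite /visits/annulus/= iter_scale_op rnormZ// exprn_ge0// ltW.
Qed.

(** A common visit at time [n] forces [(mu / lambda) ^ n < 2], which is false for
large [n]. *)
Lemma visits_almost_disjoint lambda mu : 0 < lambda -> 0 < mu -> lambda <> mu ->
  exists N, forall n, (N <= n)%N -> visits lambda n -> visits mu n -> False.
Proof.
wlog : lambda mu / lambda < mu => [wlg l0 m0 lm|lm l0 m0 _].
  have [h|h|//] := ltgtP lambda mu; first exact: wlg.
  have [|N hN] := wlg mu lambda h m0 l0; first by move/esym.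
  by exists N => n Nn vl vm; exact: (hN n).
have [|N hN] := @exprn_eventually_gt R (mu / lambda) 2.
  by rewrite ltr_pdivlMr ?mul1r.
exists N => n /hN h; rewrite !visitsE// => /andP[h1 _] /andP[_ h2].
have ln0 : 0 < lambda ^+ n by exact: exprn_gt0.
rewrite expr_div_n ltr_pdivlMr// in h.
have := rnorm_ge0 (iter n T x); nra.
Qed.

(** The comparison behind both bounds on the parameters. When [mu] visits at time
[n] and [lambda] at a later time [m], the norm of [T ^ n x] is less than
[2 * mu ^ - n] and that of [T ^ m x] exceeds [lambda ^ - m], so the norm of
[T ^ (m - n)] must be of order at least [(mu / lambda) ^ n * lambda ^ - (m - n)].
As [m - n <= K * n], the growth rate of [T] bounds [mu / lambda]. *)
Lemma visits_ratio_le lambda mu d K : 0 < lambda -> 0 < mu ->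
  1 <= d -> lambda * spectral_radius T < d ->
  (forall M, exists n m, [/\ (M <= n)%N, visits mu n, visits lambda m &
    (n <= m <= K * n)%N]) ->
  mu / lambda <= d ^+ K.
Proof.
move=> l0 m0 d1 rd pairs; rewrite leNgt; apply/negP => lt_d.
have d0 : 0 < d := lt_le_trans ltr01 d1.
have [_ _ /(_ (d / lambda))] := spectral_radiusP T_bounded.
rewrite ltr_pdivlMr// mulrC => /(_ rd)[C C0 hC].
have [|N hN] := @exprn_eventually_gt R (mu / lambda / d ^+ K) (2 * C).
  by rewrite ltr_pdivlMr ?mul1r// exprn_gt0.
have [n [m [/hN + + + /andP[nm mK]]]] := pairs N.
rewrite !visitsE// => h1 /andP[_ h2] /andP[h3 _].
have := hC (m - n)%N (iter n T x); rewrite -iterD subnK// => h4.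
have y0 := rnorm_ge0 (iter n T x).
have dmn : d ^+ (m - n) <= d ^+ (K * n).
  by apply: ler_weXn2l => //; lia.
have lm : lambda ^+ m = lambda ^+ n * lambda ^+ (m - n) by rewrite -exprD subnKC.
have ln0 : 0 < lambda ^+ n by exact: exprn_gt0.
have lmn0 : 0 < lambda ^+ (m - n) by exact: exprn_gt0.
have dK0 : 0 < d ^+ (K * n) by exact: exprn_gt0.
rewrite !expr_div_n -exprM ltr_pdivlMr// ltr_pdivlMr// in h1.
rewrite expr_div_n in h4; rewrite lm in h3.
set y := rnorm (iter n T x) in y0 h2 h4.
have h5 : lambda ^+ (m - n) * rnorm (iter m T x) <= C * d ^+ (K * n) * y.
  rewrite -ler_pdivlMl//; apply: le_trans h4 _.
  rewrite [leRHS]mulrA ler_wpM2r// [leRHS]mulrC -mulrA ler_wpM2l ?(ltW C0)//.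
  by rewrite ler_wpM2r// invr_ge0 ltW.
have h6 : 1 < lambda ^+ n * (C * d ^+ (K * n) * y).
  by rewrite (lt_le_trans h3)// -mulrA ler_wpM2l// ltW.
have h7 : 2 * C * d ^+ (K * n) * lambda ^+ n * y <= mu ^+ n * y.
  by rewrite ler_wpM2r// ltW.
have := le_lt_trans h7 h2; move: h6; lra.
Qed.

Variable Lambda : set R.
Hypothesis Lambda_pos : forall lambda, Lambda lambda -> 0 < lambda.
Hypothesis x_FHC : forall lambda, Lambda lambda -> FHC R (scale_op lambda T) x.
Variable y : X.
Hypothesis y_neq0 : y <> 0.

Lemma visits_dense lambda : Lambda lambda -> exists K N, forall n, (N <= n)%N ->
  (n.+1 <= count_upto (visits lambda) n * K)%N.
Proof.
move=> /x_FHC/(_ annulus annulus_open (annulus_nonempty y_neq0)).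
exact: (lower_density_gt0P R _).1.
Qed.

Lemma visits_consecutive lambda : Lambda lambda -> exists K N, forall n, (N <= n)%N ->
  exists m, [/\ visits lambda m, (n < m)%N & (m <= K * n)%N].
Proof. by move=> /visits_dense[K [N]]; exact: dense_bounded_ratio. Qed.

(** For each [K], the parameters whose visits have density at least [1/K] are
finitely many, since their visits are almost disjoint. *)
Lemma Lambda_countable : countable Lambda.
Proof.
pose A K : set R := [set lambda | Lambda lambda /\ exists N, forall n, (N <= n)%N ->
  (n.+1 <= count_upto (visits lambda) n * K)%N].
apply: (@sub_countable _ _ _ (\bigcup_K A K)).
  apply: subset_card_le => lambda Ll; have [K h] := visits_dense Ll.
  by exists K.
apply: bigcup_countable => // K _; apply: finite_set_countable.
apply: (@almost_disjoint_finite _ visits _ K) => [lambda []//|lambda mu [Ll _] [Lm _]].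
by apply: visits_almost_disjoint; exact: Lambda_pos.
Qed.

(** Before any late visit of [lambda] there is a visit of [mu] whose ratio to it
is bounded by a constant that depends on [mu] only; hence a bound which is
uniform in [lambda]. *)
Lemma visits_ratio_le_max mu : Lambda mu -> exists K, forall lambda, Lambda lambda ->
  mu / lambda <= Num.max 1 (lambda * spectral_radius T) ^+ K.+1.
Proof.
move=> Lm; have [K [N hN]] := visits_consecutive Lm; exists K => lambda Ll.
have l0 := Lambda_pos Ll; have m0 := Lambda_pos Lm.
(* The midpoint of [D] and the root [t] is an admissible rate below [t]. *)
have [t t0 tK] := @exprn_root R (mu / lambda) K (divr_ge0 (ltW m0) (ltW l0)).
rewrite leNgt; apply/negP; set D := Num.max _ _.
have D0 : 0 <= D by rewrite le_max ler01.
rewrite -tK ltr_pXn2r// => Dt.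
have d1 : D <= (D + t) / 2 by lra.
move: (lexx D); rewrite {1}/D ge_max => /andP[D1 Dr].
have {}d1 : 1 <= (D + t) / 2 by lra.
have {}Dr : lambda * spectral_radius T < (D + t) / 2 by lra.
suff /(visits_ratio_le l0 m0 d1 Dr) : forall M, exists n m,
    [/\ (M <= n)%N, visits mu n, visits lambda m & (n <= m <= K.+1 * n)%N].
  by rewrite -tK ler_pXn2r// ?nnegrE; lra.
move=> M.
have K0 : (0 < K)%N by have [m [_]] := hN _ (leqnn N); case: (K) => //; lia.
have [K' [N' hN']] := visits_consecutive Ll.
have [m [vm m1 _]] := hN' _ (leq_maxr (K * maxn M N) N').
have m2 : (K * maxn M N < m)%N by apply: leq_ltn_trans m1; exact: leq_maxl.
have e := divn_eq m.-1 K; have e1 := ltn_pmod m.-1 K0.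
have n0 : (maxn M N <= m.-1 %/ K)%N by rewrite leq_divRL//; lia.
have [n [vn n1 n2]] := hN _ (leq_trans (leq_maxr M N) n0).
have nK : ((m.-1 %/ K).+1 * K <= n * K)%N by rewrite leq_mul2r n1 orbT.
by exists n, m; split => //; lia.
Qed.

(** Here the visits of the fixed [lambda0] follow those of the variable [mu], so
that the ratio depends on [lambda0] only. *)
Lemma Lambda_bounded_above lambda0 : Lambda lambda0 ->
  exists B, forall lambda, Lambda lambda -> lambda <= B.
Proof.
move=> L0; have l0 := Lambda_pos L0.
have [K [N hN]] := visits_consecutive L0.
pose d := Num.max 1 (lambda0 * spectral_radius T) + 1.
exists (d ^+ K * lambda0) => mu Lm; have m0 := Lambda_pos Lm.
rewrite -ler_pdivrMr//.
have d1 : 1 <= d by rewrite ler_wpDr// le_max lexx.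
have dr : lambda0 * spectral_radius T < d.
  by rewrite ltr_pwDr// le_max lexx orbT.
apply: (visits_ratio_le l0 m0 d1 dr) => M.
have [K' [N' hN']] := visits_consecutive Lm.
have [n [vn n1 _]] := hN' _ (leq_maxr (maxn M N) N').
have n2 : (maxn M N <= n)%N by apply: leq_trans (ltnW n1); exact: leq_maxl.
have [m [vm m1 m2]] := hN n (leq_trans (leq_maxr M N) n2).
exists n, m; split => //; last by rewrite ltnW.
exact: leq_trans (leq_maxl M N) n2.
Qed.

(** With [r] the spectral radius, [mu / lambda <= max 1 (lambda * r) ^ (K + 1)]
for [lambda < mu] excludes [lambda * r <= 1]. It then reads
[mu * r <= (lambda * r) ^ (K + 2)], which bounds [lambda * r] away from 1 because
[mu * r > 1]. A second, smaller parameter [lambda0] is what gives [mu0 * r > 1]. *)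
Lemma Lambda_bounded_below lambda0 mu0 : Lambda lambda0 -> Lambda mu0 -> lambda0 < mu0 ->
  0 < spectral_radius T /\
  exists A, (spectral_radius T)^-1 < A /\ forall lambda, Lambda lambda -> A <= lambda.
Proof.
move=> L0 M0 lm; have [r0 _ _] := spectral_radiusP T_bounded.
set r := spectral_radius T in r0 *.
have [K hK] := visits_ratio_le_max M0; rewrite -/r in hK.
have pos := Lambda_pos.
have gt1 lambda : Lambda lambda -> lambda < mu0 -> 1 < lambda * r.
  move=> Ll ll; rewrite ltNge; apply/negP => le1.
  have := hK _ Ll; rewrite max_l// expr1n ler_pdivrMr ?pos// mul1r leNgt.
  by rewrite ll.
have rpos : 0 < r.
  by rewrite -(pmulr_rgt0 _ (pos _ L0)) (lt_trans ltr01)// gt1.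
have m1 : 1 < mu0 * r by rewrite (lt_trans (gt1 _ L0 lm))// ltr_pM2r.
have key lambda : Lambda lambda -> mu0 * r <= (lambda * r) ^+ K.+2.
  move=> Ll; have [lm'|ml] := ltP lambda mu0.
    have g := gt1 _ Ll lm'; have := hK _ Ll; rewrite max_r ?(ltW g)//.
    rewrite ler_pdivrMr ?pos// => h; rewrite [leRHS]exprSr mulrA ler_wpM2r// ltW.
  have h : mu0 * r <= lambda * r by rewrite ler_wpM2r// ltW.
  by rewrite (le_trans h)// ler_eXnr// (le_trans (ltW m1)).
split => //.
have [t t0 tK] := @exprn_root R (mu0 * r) K.+1 (le_trans ler01 (ltW m1)).
have t1 : 1 < t.
  rewrite ltNge; apply/negP => t1; move: m1; rewrite -tK ltNge.
  by rewrite exprn_ile1.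
exists (t / r); split; first by rewrite ltr_pdivlMr// mulVf// gt_eqF.
move=> lambda Ll; rewrite ler_pdivrMr// -(@ler_pXn2r _ K.+2)// ?nnegrE ?tK ?key//.
by rewrite mulr_ge0// ltW// pos.
Qed.
End CommonVector.

(** * Construction of a common vector *)

(** The value at [0] is set to 0 so that, with truncated subtraction, one of the
values at [n - m] and [m - n] always vanishes. *)
Definition geometric_tail {R : realType} (q : R) (N d : nat) : R :=
  if (0 < d)%N && (N <= d)%N then q ^+ d else 0.

Section GeometricTail.
Context {R : realType} (q : R) (N : nat).
Hypothesis q_lt1 : 0 < q < 1.
Let G := geometric_tail q N.
Let q_gt0 : 0 < q. Proof. by case/andP: q_lt1. Qed.
Let q_le1 : 0 < 1 - q. Proof. by case/andP: q_lt1; rewrite subr_gt0. Qed.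

Lemma geometric_tail_ge0 d : 0 <= G d.
Proof. by rewrite /G /geometric_tail; case: ifP => // _; rewrite exprn_ge0// ltW. Qed.

Lemma geometric_tail_sum p : \sum_(0 <= d < p) G d <= q ^+ N / (1 - q).
Proof.
suff : \sum_(0 <= d < p) G d <= (q ^+ N - q ^+ (maxn N p)) / (1 - q).
  move=> h; apply: le_trans h _; rewrite ler_wpM2r ?invr_ge0 ?(ltW q_le1)//.
  by rewrite gerBl exprn_ge0// ltW.
elim: p => [|p IH]; first by rewrite big_geq// maxn0 subrr mul0r.
rewrite big_nat_recr//=; apply: le_trans (lerD IH (lexx _)) _.
have [Np|pN] := leqP N p; last first.
  rewrite (maxn_idPl pN) /G /geometric_tail.
  by rewrite [(N <= p)%N]leqNgt pN andbF addr0.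
rewrite (maxn_idPr (leqW Np)).
have Gp : G p <= q ^+ p.
  by rewrite /G /geometric_tail; case: ifP => // _; rewrite exprn_ge0// ltW.
apply: le_trans (lerD (lexx _) Gp) _.
have -> : (q ^+ N - q ^+ p) / (1 - q) + q ^+ p = (q ^+ N - q ^+ p.+1) / (1 - q).
  by rewrite exprS; field; rewrite gt_eqF.
by [].
Qed.

Lemma two_sided_sum_le (a : nat -> R) m p :
  (forall n, (n < m)%N -> a n <= G (m - n)) ->
  (forall n, (m < n)%N -> a n <= G (n - m)) ->
  \sum_(0 <= n < p | n != m) a n <= 2 * (q ^+ N / (1 - q)).
Proof.
move=> lt_m gt_m.
have G0 : G 0%N = 0 by [].
have right : \sum_(0 <= n < p) G (n - m) <= q ^+ N / (1 - q).
  elim: m p {lt_m gt_m} => [|m IH] p.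
    by under eq_bigr do rewrite subn0; exact: geometric_tail_sum.
  case: p => [|p]; first by rewrite (le_trans _ (geometric_tail_sum 0))// !big_geq.
  by rewrite big_nat_recl//= G0 add0r IH.
have left : \sum_(0 <= n < p) G (m - n) <= q ^+ N / (1 - q).
  apply: le_trans (geometric_tail_sum m.+1).
  elim: m p {lt_m gt_m right} => [|m IH] p.
    rewrite big1 => [|i _]; last by rewrite sub0n.
    by rewrite sumr_ge0// => i _; exact: geometric_tail_ge0.
  case: p => [|p]; first by rewrite big_geq// sumr_ge0// => i _; exact: geometric_tail_ge0.
  rewrite [leLHS]big_nat_recl// [leRHS]big_nat_recr// subn0 [leLHS]addrC.
  by apply: lerD => //; exact: IH.
rewrite mulrDl mul1r; apply: le_trans (lerD left right); rewrite -big_split/=.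
rewrite big_mkcond/=; apply: ler_sum => n _.
have [nm|mn|_] /= := ltngtP n m.
- by rewrite ler_wpDr ?geometric_tail_ge0 ?lt_m.
- by rewrite ler_wpDl ?geometric_tail_ge0 ?gt_m.
by rewrite addr_ge0 ?geometric_tail_ge0.
Qed.
End GeometricTail.

(** The term contributed by another visit at distance [d] is a product of [q ^ d]
to the cube, a ratio of parameters [Q] and a constant [c] attached to the target.
One factor [q ^ d] absorbs [Q], one absorbs [c], and one is left to be summed. *)
Lemma three_factors_le {R : realType} (Q c t a : R) : 0 <= Q -> 0 <= c -> 0 <= t ->
  0 <= a <= 1 -> Q * t <= 1 -> c * t <= 1 -> Q * c * t ^+ 3 * a <= t.
Proof.
move=> Q0 c0 t0 /andP[a0 a1] Qt ct.
have -> : Q * c * t ^+ 3 * a = (Q * t) * (c * t) * a * t by ring.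
rewrite ler_piMl// mulr_ile1 ?mulr_ge0// mulr_ile1 ?mulr_ge0//.
Qed.

Section FrequentApproximation.
Context {R : realType} {s : scalars} {X : completeNormedModType (scalar_field R s)}.
Variables (T : {linear X -> X}) (S : X -> X) (X0 : set X).
Hypothesis T_bounded : bounded_near T (nbhs (0 : X)).
Hypothesis S_X0 : forall x, X0 x -> X0 (S x).
Hypothesis TS : forall x, X0 x -> T (S x) = x.
Variables (A B q : R).
Hypotheses (A_gt0 : 0 < A) (q_lt1 : 0 < q < 1).
Hypothesis S_decay : forall x, X0 x -> exists C, forall d,
  rnorm (iter d S x) <= C * (q ^+ 3 * A) ^+ d.
Hypothesis T_decay : forall x, X0 x -> exists C, forall d,
  rnorm (iter d T x) <= C * (q ^+ 3 / B) ^+ d.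

Lemma iter_S_X0 d x : X0 x -> X0 (iter d S x).
Proof. by move=> x0; elim: d => //= d; exact: S_X0. Qed.

Lemma iterTS d x : X0 x -> iter d T (iter d S x) = x.
Proof.
by move=> x0; elim: d => //= d IH; rewrite -iterS iterSr TS//; exact: iter_S_X0.
Qed.

Variables (lam : nat -> R) (xs : nat -> X) (eps : nat -> R).
Hypothesis lam_AB : forall k, A <= lam k <= B.
Hypothesis xs_X0 : forall k, X0 (xs k).
Hypothesis eps_gt0 : forall k, 0 < eps k.

(** The vector is the sum over [k] and [n] in [E k] of
[lam k ^ - n * S ^ n (xs k)]. At a time [m] in [E j], the operator [lam j * T]
iterated [m] times sends the term of index [m] to [xs j], and the term of index
[n] in [E k] to a multiple of [S ^ (n - m) (xs k)] or [T ^ (m - n) (xs k)]. The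
multiple contains [(lam j / lam k) ^ min m n], which may be exponentially large;
the geometric separation of [E j] and [E k] when [j] and [k] differ, with [L]
chosen so that [B / A <= q ^ - L], makes it at most [q ^ - d] where [d] is the
distance of [m] and [n]. *)
Lemma frequent_approximation : exists (x : X) (E : nat -> set nat),
  (forall k, exists K M, forall n, (M <= n)%N -> (n.+1 <= count_upto (E k) n * K)%N) /\
  (forall k m, E k m -> rnorm (iter m (scale_op (lam k) T) x - xs k) <= eps k).
Proof.
have [q0 q1] := andP q_lt1.
have AB : A <= B by have /andP[h1 h2] := lam_AB 0; exact: le_trans h1 h2.
have B_gt0 : 0 < B by exact: lt_le_trans AB.
have /choice[C hC] : forall k, exists C, [/\ 0 < C,
    forall d, rnorm (iter d S (xs k)) <= C * (q ^+ 3 * A) ^+ d &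
    forall d, rnorm (iter d T (xs k)) <= C * (q ^+ 3 / B) ^+ d].
  move=> k; have [C1 h1] := S_decay (xs_X0 k); have [C2 h2] := T_decay (xs_X0 k).
  have C10 := ler_norm C1; have C20 := ler_norm C2.
  have := normr_ge0 C1; have := normr_ge0 C2 => C2p C1p.
  exists (`|C1| + `|C2| + 1); split; first by lra.
  - move=> d; apply: le_trans (h1 d) _; rewrite ler_wpM2r//; last by lra.
    by rewrite exprn_ge0// mulr_ge0 ?exprn_ge0 ?ltW.
  - move=> d; apply: le_trans (h2 d) _; rewrite ler_wpM2r//; last by lra.
    by rewrite exprn_ge0// divr_ge0 ?exprn_ge0 ?ltW.
have q01 : 0 <= q < 1 by rewrite ltW.
have /choice[N hN] : forall k, exists N, (forall d, (N <= d)%N -> C k * q ^+ d <= 1) /\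
    2 * (q ^+ N / (1 - q)) <= eps k.
  move=> k; have [C0 _ _] := hC k.
  have [|N1 h1] := @geometric_eventually_lt R q (C k)^-1 q01; first by rewrite invr_gt0.
  have [|N2 h2] := @geometric_eventually_lt R q (eps k * (1 - q) / 2) q01.
    by rewrite divr_gt0// mulr_gt0// subr_gt0.
  exists (maxn N1 N2); split=> [d Nd|].
    rewrite -ler_pdivlMl// mulr1; apply/ltW/h1; exact: leq_trans (leq_maxl _ _) Nd.
  have := h2 _ (leq_maxr N1 N2); set t := q ^+ _ => h.
  by rewrite mulrA ler_pdivrMr ?subr_gt0//; lra.
have [|L /(_ L (leqnn L)) hL] := @geometric_eventually_lt R q (A / B) q01.
  by rewrite divr_gt0.
have [E [E_dense E_ge E_disj E_gap]] := separated_sets L N.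
have lam_gt0 k : 0 < lam k by have /andP[h _] := lam_AB k; exact: lt_le_trans h.
(* [p] is the earlier of the two visiting times and [d] their distance. *)
have ratio j k p d : j = k \/ (L * p <= d)%N -> (lam j / lam k) ^+ p * q ^+ d <= 1.
  case=> [->|Lp].
    by rewrite divff ?gt_eqF// expr1n mul1r exprn_ile1// ltW.
  have /andP[Aj jB] := lam_AB j; have /andP[Ak kB] := lam_AB k.
  have lk0 : 0 <= lam j / lam k by rewrite divr_ge0 ?(ltW (lam_gt0 _)).
  have le_jk : lam j / lam k <= B / A.
    apply: ler_pM => //; first exact: ltW.
      by rewrite invr_ge0 ltW.
    by rewrite lef_pV2 ?posrE.
  apply: (@le_trans _ _ ((B / A * q ^+ L) ^+ p)).
    rewrite [leRHS]exprMn -exprM; apply: ler_pM.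
    - exact: exprn_ge0.
    - by rewrite exprn_ge0// ltW.
    - by rewrite lerXn2r// nnegrE (le_trans lk0).
    - by rewrite ler_wiXn2l// ltW.
  apply: exprn_ile1; first by rewrite mulr_ge0 ?divr_ge0 ?exprn_ge0// ltW.
  by rewrite -ler_pdivlMl ?divr_gt0// mulr1 invf_div ltW.
have /choice[v hv] : forall n, exists v : X,
    (forall k, E k n -> v = of_real s (lam k ^- n) *: iter n S (xs k)) /\
    ((forall k, ~ E k n) -> v = 0).
  move=> n; have [[k kn]|none] := pselect (exists k, E k n).
    exists (of_real s (lam k ^- n) *: iter n S (xs k)); split=> [j jn|/(_ k)//].
    by rewrite (E_disj _ _ _ jn kn).
  exists 0; split=> [k kn|//]; by exfalso; apply: none; exists k.
have A_le k d : 0 <= (A / lam k) ^+ d <= 1.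
  have /andP[Ak _] := lam_AB k.
  rewrite exprn_ge0 ?exprn_ile1 ?divr_ge0 ?(ltW A_gt0) ?(ltW (lam_gt0 k))//.
  by rewrite ler_pdivrMr ?mul1r.
have B_le k d : 0 <= (lam k / B) ^+ d <= 1.
  have /andP[_ kB] := lam_AB k.
  rewrite exprn_ge0 ?exprn_ile1 ?divr_ge0 ?(ltW B_gt0) ?(ltW (lam_gt0 k))//.
  by rewrite ler_pdivrMr ?mul1r.
(* The separation from time 0 makes the series converge geometrically. *)
have v_le n : rnorm (v n) <= 1 * q ^+ n.
  rewrite mul1r; have [[k kn]|none] := pselect (exists k, E k n); last first.
    by rewrite (hv n).2 ?rnorm0 ?exprn_ge0 ?ltW// => k kn; apply: none; exists k.
  have [C0 hS _] := hC k; have lk := lam_gt0 k.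
  rewrite ((hv n).1 _ kn) rnormZ ?invr_ge0 ?(exprn_ge0 _ (ltW lk))//.
  have qn1 : 1 * q ^+ n <= 1 by rewrite mul1r exprn_ile1// ltW.
  have Cq : C k * q ^+ n <= 1 by apply: (hN k).1; exact: E_ge.
  apply: le_trans (three_factors_le ler01 (ltW C0) (exprn_ge0 n (ltW q0)) (A_le k n) qn1 Cq).
  rewrite ler_pdivrMl ?exprn_gt0//; apply: le_trans (hS n) _.
  rewrite expr_div_n exprMn -!exprM mulnC mul1r [leRHS]mulrC -!mulrA.
  by rewrite mulVf ?mulr1// gt_eqF// exprn_gt0.
have /cvg_ex[x vx] : cvgn (series v) by exact: cvg_series_geometric v_le.
exists x, E; split => // j m jm.
pose w n := iter m (scale_op (lam j) T) (v n).
have wx : series w @ \oo --> iter m (scale_op (lam j) T) x.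
  rewrite iter_scale_op.
  have -> : series w = (fun n => of_real s (lam j ^+ m) *: iter m T (series v n)).
    apply/funext => n; rewrite /series/= iter_sum scaler_sumr; apply: eq_bigr => i _.
    by rewrite /w iter_scale_op.
  by apply: cvgZl_tmp; exact: cvg_iter.
have wm : w m = xs j.
  rewrite /w iter_scale_op ((hv m).1 _ jm) iter_scaler iterTS// scalerA -of_realM.
  by rewrite divff ?of_real1 ?scale1r// expf_neq0// gt_eqF.
rewrite -wm; apply: le_trans (hN j).2.
apply: (rnorm_series_sub_le wx) => p.
have [Cj0 _ _] := hC j; have lj := lam_gt0 j.
have w_norm k n : E k n -> rnorm (w n) =
    lam j ^+ m / lam k ^+ n * rnorm (iter m T (iter n S (xs k))).
  move=> kn; rewrite /w iter_scale_op ((hv n).1 _ kn) iter_scaler.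
  by rewrite !rnormZ ?invr_ge0 ?(exprn_ge0 _ (ltW _))// mulrA.
have w0 n : ~ (exists k, E k n) -> rnorm (w n) = 0.
  move=> none; rewrite /w iter_scale_op (hv n).2 => [|k kn]; last by apply: none; exists k.
  by rewrite -[X in iter m T X](scale0r 0) iter_scaler scale0r scaler0 rnorm0.
apply: two_sided_sum_le => // n nm;
    (have [[k kn]|none] := pselect (exists k, E k n); last by
      rewrite w0//; exact: geometric_tail_ge0);
    have [Ck0 hS hT] := hC k; have lk := lam_gt0 k; rewrite (w_norm k n kn).
- have [h1 h2 h3] := E_gap _ _ _ _ kn jm nm.
  rewrite /geometric_tail subn_gt0 nm h2/=.
  move: h1 h3 (subnK (ltnW nm)); set d := (m - n)%N => h1 h3 dn.
  have Cq : C k * q ^+ d <= 1 by exact: (hN k).1.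
  have Qq : (lam j / lam k) ^+ n * q ^+ d <= 1 by apply: ratio; case: h3 => [->|]; [left|right].
  have Q0 : 0 <= (lam j / lam k) ^+ n by rewrite exprn_ge0// divr_ge0// ltW.
  have := three_factors_le Q0 (ltW Ck0) (exprn_ge0 d (ltW q0)) (B_le j d) Qq Cq.
  apply: le_trans; rewrite -dn iterD iterTS//.
  have le_l : 0 <= lam j ^+ (d + n) / lam k ^+ n by rewrite divr_ge0// exprn_ge0// ltW.
  apply: le_trans (ler_wpM2l le_l (hT d)) _; rewrite le_eqVlt; apply/orP; left; apply/eqP.
  rewrite exprD !expr_div_n -!exprM mulnC.
  by field; rewrite !expf_neq0// gt_eqF.
- have [h1 h2 h3] := E_gap _ _ _ _ jm kn nm.
  rewrite /geometric_tail subn_gt0 nm h1/=.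
  move: h2 h3 (subnKC (ltnW nm)); set d := (n - m)%N => h2 h3 dn.
  have Cq : C k * q ^+ d <= 1 by exact: (hN k).1.
  have Qq : (lam j / lam k) ^+ m * q ^+ d <= 1 by exact: ratio.
  have Q0 : 0 <= (lam j / lam k) ^+ m by rewrite exprn_ge0// divr_ge0// ltW.
  have := three_factors_le Q0 (ltW Ck0) (exprn_ge0 d (ltW q0)) (A_le k d) Qq Cq.
  apply: le_trans; rewrite -dn iterD iterTS; last exact: iter_S_X0.
  have le_l : 0 <= lam j ^+ m / lam k ^+ (m + d) by rewrite divr_ge0// exprn_ge0// ltW.
  apply: le_trans (ler_wpM2l le_l (hS d)) _; rewrite le_eqVlt; apply/orP; left; apply/eqP.
  rewrite exprD !expr_div_n exprMn -!exprM mulnC.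
  by field; rewrite !expf_neq0// gt_eqF.
Qed.
End FrequentApproximation.

Lemma countable_enumeration {I : Type} (A : set I) : A !=set0 -> countable A ->
  exists g : nat -> I, (forall n, A (g n)) /\ (forall a, A a -> exists n, g n = a).
Proof.
move=> [a0 Aa0] /countable_injP[f f_inj].
have /choice[g hg] : forall n, exists a, A a /\ (forall b, A b -> f b = n -> a = b).
  move=> n; have [[a [Aa fa]]|none] := pselect (exists a, A a /\ f a = n).
    exists a; split=> // b Ab fb; apply: f_inj; rewrite ?inE//; congruence.
  by exists a0; split=> // b Ab fb; exfalso; apply: none; exists b.
exists g; split=> [n|a Aa]; first exact: (hg n).1.
by exists (f a); exact: (hg (f a)).2.
Qed.

Lemma count_upto_subset (E F : set nat) n : E `<=` F ->
  (count_upto E n <= count_upto F n)%N.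
Proof.
move=> EF; apply: subset_leq_card; apply/fintype.subsetP => i.
by rewrite !inE; exact: EF.
Qed.

Section CommonFHC.
Context {R : realType} {s : scalars} {X : completeNormedModType (scalar_field R s)}.
Variables (T : {linear X -> X}) (S : X -> X) (X0 : set X).
Hypothesis X_separable : separable X.
Hypothesis T_bounded : bounded_near T (nbhs (0 : X)).
Hypothesis X0_dense : dense X0.
Hypothesis S_X0 : forall x, X0 x -> X0 (S x).
Hypothesis TS : forall x, X0 x -> T (S x) = x.

Lemma dense_rnorm (D : set X) (x : X) (e : R) : dense D -> 0 < e ->
  exists2 y, D y & rnorm (x - y) < e.
Proof.
move=> /(_ [set y | rnorm (x - y) < e]) D_dense e0.
have [||y [/= xy Dy]] := D_dense; last by exists y.
- by exists x; rewrite /= subrr rnorm0.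
- apply/open_rnormP => y /= xy; exists (e - rnorm (x - y)); first by rewrite subr_gt0.
  move=> z yz; have := rnormD (x - y) (y - z); rewrite addrA subrK; lra.
Qed.

(** Every triple made of a parameter, a point of a countable dense set and a
precision is encoded as a target. The targets themselves are taken in [X0], close
to the chosen points. *)
Lemma common_FHC_of_decay (A B q : R) (Lambda : set R) : 0 < A -> 0 < q < 1 ->
  (forall x, X0 x -> exists C, forall d, rnorm (iter d S x) <= C * (q ^+ 3 * A) ^+ d) ->
  (forall x, X0 x -> exists C, forall d, rnorm (iter d T x) <= C * (q ^+ 3 / B) ^+ d) ->
  countable Lambda -> Lambda !=set0 -> (forall lambda, Lambda lambda -> A <= lambda <= B) ->
  (\bigcap_(lambda in Lambda) FHC R (scale_op lambda T)) !=set0.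
Proof.
move=> A0 q01 S_decay T_decay L_countable L_nonempty LAB.
have [gL [gLin gLsurj]] := countable_enumeration L_nonempty L_countable.
have [D [D_countable D_dense]] := X_separable.
have [gD [gDin gDsurj]] : exists g : nat -> X, (forall n, D (g n)) /\
    (forall a, D a -> exists n, g n = a).
  apply: countable_enumeration => //.
  by have [y Dy _] := dense_rnorm 0 D_dense ltr01; exists y.
pose target k := odflt (0, 0, 0)%N (unpickle k : option (nat * nat * nat)).
pose eps k : R := (target k).2.+1%:R^-1.
have eps_gt0 k : 0 < eps k by rewrite invr_gt0 ltr0n.
have /choice[xs hxs] : forall k, exists y, X0 y /\ rnorm (gD (target k).1.2 - y) < eps k.
  by move=> k; have [y X0y hy] := dense_rnorm (gD (target k).1.2) X0_dense (eps_gt0 k); exists y.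
have [x [E [E_dense hE]]] := @frequent_approximation _ _ _ T S X0 T_bounded S_X0 TS
  A B q A0 q01 S_decay T_decay (fun k => gL (target k).1.1) xs eps
  (fun k => LAB _ (gLin _)) (fun k => (hxs k).1) eps_gt0.
exists x => lambda /gLsurj[i <-] U U_open [z Uz]; apply/lower_density_gt0P.
have [e e0 zU] := (open_rnormP U).1 U_open z Uz.
have e20 : 0 < e / 2 by rewrite divr_gt0.
have [_ /gDsurj[n <-] zn] := dense_rnorm z D_dense e20.
pose p := Num.truncn (4 / e).
pose k := pickle (i, n, p).
have tk : target k = (i, n, p) by rewrite /target pickleK.
have eps_small : eps k < e / 4.
  have h : 4 / e < p.+1%:R by exact: truncnS_gt.
  by rewrite /eps tk -[e / 4]invrK invf_div ltf_pV2 ?posrE ?ltr0n// divr_gt0.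
have [K [M hM]] := E_dense k.
exists K, M => m /hM h; apply: leq_trans h _; rewrite leq_mul2r; apply/orP; right.
apply: count_upto_subset => l /hE; rewrite tk /= => h1.
apply: zU; have [_] := hxs k; rewrite tk/= => h2.
set y := iter l _ x in h1 *.
have := rnormD (z - gD n) (gD n - y); rewrite addrA subrK.
have := rnormD (gD n - xs k) (xs k - y); rewrite addrA subrK.
rewrite -[xs k - y]opprB rnormN; lra.
Qed.

Lemma unconditionally_convergent_bounded (u : nat -> X) : unconditionally_convergent u ->
  exists2 C : R, 0 < C & forall n, rnorm (u n) <= C.
Proof.
move=> /(_ id); have -> : u \o id = u by [].
move=> /(_ (Bijective (fun _ => erefl) (fun _ => erefl))); exact: cvgn_rnorm_bounded.
Qed.

(** The terms of a convergent series are bounded, so the exponents provide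
exponential decay rates. *)
Lemma a_exponent_decay (b : R) x : (a_exponent X0 S < b%:E)%E -> X0 x ->
  exists C, forall d, rnorm (iter d S x) <= C * b ^+ d.
Proof.
move=> /ereal_inf_lt[_ [lambda [l0 hl] <-]]; rewrite lte_fin => lb X0x.
have [C C0 hC] := unconditionally_convergent_bounded (hl x X0x).
exists C => d; have := hC d; rewrite rnormZ ?invr_ge0 ?exprn_ge0 ?(ltW l0)//.
rewrite ler_pdivrMl ?exprn_gt0// => h; apply: le_trans h _; rewrite mulrC.
by rewrite ler_wpM2l ?(ltW C0)// lerXn2r ?nnegrE ?(ltW lb)// ltW// (lt_trans l0).
Qed.

Lemma b_exponent_decay (b : R) x : b_exponent T X0 = +oo%E -> 0 < b -> X0 x ->
  exists C, forall d, rnorm (iter d T x) <= C * b ^+ d.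
Proof.
move=> b_eq b0 X0x.
have : (b^-1%:E < b_exponent T X0)%E by rewrite b_eq ltry.
move=> /ereal_sup_gt[_ [lambda [l0 hl] <-]]; rewrite lte_fin => lb.
have [C C0 hC] := unconditionally_convergent_bounded (hl x X0x).
exists C => d; have := hC d; rewrite iter_scale_op rnormZ ?exprn_ge0 ?(ltW l0)//.
rewrite -ler_pdivlMl ?exprn_gt0// => h; apply: le_trans h _; rewrite mulrC.
rewrite ler_wpM2l ?(ltW C0)// -exprVn lerXn2r ?nnegrE ?invr_ge0 ?(ltW l0) ?(ltW b0)//.
by rewrite -[b]invrK lef_pV2 ?posrE ?invr_gt0// ltW.
Qed.

Lemma a_exponent_ge0 : (0 <= a_exponent X0 S)%E.
Proof. by apply: le_ereal_inf_tmp => _ [lambda [l0 _] <-]; rewrite lee_fin ltW. Qed.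

(** The closure of [Lambda] has a least element [A], still above the exponent
[a], and a greatest element [B]. The gap between [a] and [A] leaves room for a
[q < 1] with [a < q ^ 3 * A]; the rate [q ^ 3 / B] is available for [T] because
the exponent [b] is infinite. *)
Lemma common_FHC_sufficient (Lambda : set R) : b_exponent T X0 = +oo%E ->
  Lambda !=set0 -> countable Lambda ->
  relatively_compact_in [set lambda : R | (a_exponent X0 S < lambda%:E)%E] Lambda ->
  (\bigcap_(lambda in Lambda) FHC R (scale_op lambda T)) !=set0.
Proof.
move=> b_eq L_nonempty L_countable [cL La].
have cL0 : closure Lambda !=set0.
  by have [l Ll] := L_nonempty; exists l; exact: subset_closure.
have idc : {within closure Lambda, continuous (id : R -> R)}.
  by apply: continuous_subspaceT => r; exact: cvg_id.
have [A cA hA] := compact_EVT_min cL0 cL idc.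
have [B cB hB] := compact_EVT_max cL0 cL idc.
have aA : (a_exponent X0 S < A%:E)%E by apply: La; rewrite inE in cA.
have a0 := a_exponent_ge0.
have [a aE] : exists a : R, a_exponent X0 S = a%:E.
  by exists (fine (a_exponent X0 S)); rewrite fineK// ge0_fin_numE// (lt_trans aA)// ltry.
rewrite aE lte_fin lee_fin in aA a0.
have A0 : 0 < A := le_lt_trans a0 aA.
have LAB lambda : Lambda lambda -> A <= lambda <= B.
  by move=> /subset_closure Ll; rewrite hA ?hB ?inE.
have B0 : 0 < B.
  by have [l /LAB/andP[h1 h2]] := L_nonempty; rewrite (lt_le_trans A0)// (le_trans h1).
have aA1 : a / A < 1 by rewrite ltr_pdivrMr ?mul1r.
have aA0 : 0 <= a / A by rewrite divr_ge0// ltW.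
have [|q q0 q3] := @exprn_root R ((a / A + 1) / 2) 2; first by lra.
have q1 : q < 1.
  rewrite ltNge; apply/negP => /(exprn_ege1 3); rewrite q3; lra.
have qpos : 0 < q.
  rewrite lt_def q0 andbT; apply/eqP => q00; move: q3; rewrite q00 expr0n/=; lra.
apply: (@common_FHC_of_decay A B q Lambda) => //; first by rewrite qpos.
- move=> x; apply: a_exponent_decay; rewrite aE lte_fin -ltr_pdivrMr// q3; lra.
- by move=> x; apply: b_exponent_decay => //; rewrite divr_gt0// exprn_gt0.
Qed.
End CommonFHC.

(** * Proof of the equivalence *)

Section Nontriviality.
Context {R : realType} {s : scalars} {X : completeNormedModType (scalar_field R s)}.
Variables (T : {linear X -> X}) (S : X -> X) (X0 : set X).
Hypothesis T_bounded : bounded_near T (nbhs (0 : X)).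

(** On the zero space the spectral radius is 0, whose inverse is [+oo], while
every series converges and the exponent [a] is finite. *)
Lemma nontrivial_of_a_exponent : a_exponent X0 S = ((spectral_radius T)%:E^-1)%E ->
  exists y : X, y <> 0.
Proof.
move=> a_eq; apply: contrapT => triv.
have X_0 (y : X) : y = 0 by apply: contrapT => y0; apply: triv; exists y.
have [r0 r1 _] := spectral_radiusP T_bounded.
have T0 : opnorm T <= 0.
  by apply: opnorm_le => // y; rewrite mul0r (X_0 (T y)) rnorm0.
have rE : spectral_radius T = 0 by apply/eqP; rewrite eq_le r0 (le_trans r1).
have : (a_exponent X0 S <= 1%:E)%E.
  apply: ereal_inf_lbound; exists 1 => //; split => // x _ sigma _.
  apply: (@cvg_series_geometric _ _ _ _ 0 0); first by rewrite lexx ltr01.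
  by move=> n; rewrite (X_0 (_ n)) rnorm0 mul0r.
by rewrite a_eq rE inve0.
Qed.
End Nontriviality.

Theorem corollary2p12 (R : realType) (s : scalars)
    (X : completeNormedModType (scalar_field R s))
    (X_separable : separable X)
    (T : {linear X -> X}) (T_bounded : bounded_near T (nbhs (0 : X)))
    (Lambda : set R) (Lambda_pos : forall lambda, Lambda lambda -> 0 < lambda)
    (Lambda_two : exists lambda mu, [/\ Lambda lambda, Lambda mu & lambda <> mu])
    (X0 : set X) (X0_dense : dense X0)
    (S : X -> X) (S_X0 : forall x, X0 x -> X0 (S x))
    (TS : forall x, X0 x -> T (S x) = x)
    (a_eq : a_exponent X0 S = ((spectral_radius T)%:E^-1)%E)
    (b_eq : b_exponent T X0 = +oo%E) :
  (\bigcap_(lambda in Lambda) FHC R (scale_op lambda T)) !=set0 <->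
  countable Lambda /\
  relatively_compact_in
    [set lambda : R | ((spectral_radius T)%:E^-1 < lambda%:E)%E] Lambda.
Proof.
split=> [[x x_FHC]|[L_countable]]; last first.
  rewrite -a_eq => L_compact.
  apply: (common_FHC_sufficient X_separable T_bounded X0_dense S_X0 TS b_eq) => //.
  by have [lambda [mu [Ll _ _]]] := Lambda_two; exists lambda.
have [y y0] := nontrivial_of_a_exponent T_bounded a_eq.
split; first exact: (Lambda_countable Lambda_pos x_FHC y0).
have [l [m [Ll Lm lm]]] : exists l m, [/\ Lambda l, Lambda m & l < m].
  have [l [m [Ll Lm /eqP]]] := Lambda_two; rewrite neq_lt => /orP[h|h].
    by exists l, m.
  by exists m, l.
have [r0 [A [rA LA]]] := Lambda_bounded_below T_bounded Lambda_pos x_FHC y0 Ll Lm lm.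
have [B LB] := Lambda_bounded_above T_bounded Lambda_pos x_FHC y0 Ll.
have clAB : closure Lambda `<=` `[A, B].
  have /closure_id -> : closed (`[A, B] : set R) by exact: interval_closed.
  by apply: closureS => r Lr /=; rewrite in_itv/= LA// LB.
split.
  apply: (subclosed_compact _ (@segment_compact R A B) clAB); exact: closed_closure.
move=> r /clAB /=; rewrite in_itv/= => /andP[Ar _].
by rewrite inver gt_eqF// lte_fin (lt_le_trans rA).
Qed.
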